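(* For every $n\geq 1$, $|\mathcal{IO}_n^-|=|\mathcal{IO}_n^+|=2^{n-1}$.
   Context: Let $\Omega_n=\{1,\ldots,n\}$ with the usual linear order; transformations are written on the right of their arguments. $\mathcal{IO}_n$ is the monoid, under composition, of all full transformations $\alpha:\Omega_n\to\Omega_n$ that are order-preserving ($x\leq y$ implies $x\alpha\leq y\alpha$) and whose image is an interval of $\Omega_n$ (if $x\leq y\leq z$ and $x,z\in\mathrm{Im}(\alpha)$ then $y\in\mathrm{Im}(\alpha)$). $\mathcal{IO}_n^-$ is the submonoid of those $\alpha\in\mathcal{IO}_n$ with $x\alpha\leq x$ for all $x\in\Omega_n$, and $\mathcal{IO}_n^+$ is the submonoid of those $\alpha\in\mathcal{IO}_n$ with $x\leq x\alpha$ for all $x\in\Omega_n$. *)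

(* Defs.v *)
From mathcomp Require Import all_boot.

Set Implicit Arguments.
Unset Strict Implicit.
Unset Printing Implicit Defensive.

(* The chain Omega_n = {1, ..., n} is represented by 'I_n = {0, ..., n-1}, with
   the order of nat: the shift x |-> x - 1 is an order isomorphism. *)
Definition transf (n : nat) := {ffun 'I_n -> 'I_n}.

Definition order_preserving n (a : transf n) : bool :=
  [forall x : 'I_n, forall y : 'I_n, (x <= y) ==> (a x <= a y)].

Definition interval_image n (a : transf n) : bool :=
  [forall x : 'I_n, forall y : 'I_n, forall z : 'I_n,
     [&& x <= y, y <= z, x \in codom a & z \in codom a] ==> (y \in codom a)].

Definition IO (n : nat) : {set transf n} :=
  [set a : transf n | order_preserving a && interval_image a].

Definition IO_minus (n : nat) : {set transf n} :=
  [set a in IO n | [forall x : 'I_n, a x <= x]].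

Definition IO_plus (n : nat) : {set transf n} :=
  [set a in IO n | [forall x : 'I_n, x <= a x]].

(* Main.v *)
Require Import Defs.
From mathcomp Require Import all_boot.

Set Implicit Arguments.
Unset Strict Implicit.
Unset Printing Implicit Defensive.

(** An element of IO_n^- fixes the least point, and, its image being an interval,
    it increases by 0 or 1 at each step; any such sequence of n - 1 steps occurs.
    Conjugation by the order reversal of the chain exchanges IO_n^- and IO_n^+. *)

Lemma IO_minusP n (a : transf n) :
  reflect [/\ {homo a : x y / x <= y}, interval_image a & forall x, a x <= x]
          (a \in IO_minus n).
Proof.
rewrite 2!inE -andbA; apply: (iffP and3P) => -[a_mono aI a_le]; split=> //.
- by move=> x y; move/forallP/(_ x)/forallP/(_ y)/implyP: a_mono.
- exact/forallP.
- by apply/forallP=> x; apply/forallP=> y; apply/implyP/a_mono.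
- exact/forallP.
Qed.

(** A larger jump would skip the value [(a x).+1], which the interval condition puts in the image.
    Its preimage [z] satisfies [z <= x] or [y <= z], and monotonicity excludes both. *)
Lemma interval_image_succ n (a : transf n) (x y : 'I_n) :
  {homo a : x y / x <= y} -> interval_image a -> y = x.+1 :> nat ->
  a y <= (a x).+1.
Proof.
move=> a_mono aI yE; rewrite leqNgt; apply/negP=> gap.
pose v := Ordinal (ltn_trans gap (ltn_ord (a y))).
have /codomP[z vE] : v \in codom a.
  move/forallP/(_ (a x))/forallP/(_ v)/forallP/(_ (a y))/implyP: aI; apply.
  by rewrite /= leqnSn ltnW // !codom_f.
have {}vE : (a x).+1 = a z by rewrite -vE.
have [zx|] := leqP z x; first by have := a_mono _ _ zx; rewrite -vE ltnn.
by rewrite -yE => /a_mono; rewrite -vE leqNgt gap.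
Qed.

Lemma count_take_succ (s : seq bool) k :
  k < size s -> count id (take k.+1 s) = count id (take k s) + nth false s k.
Proof. by move=> ks; rewrite (take_nth false ks) -cats1 count_cat /= addn0. Qed.

Lemma count_take_le (s : seq bool) k : count id (take k s) <= k.
Proof. by apply: leq_trans (count_size _ _) _; rewrite size_take_min geq_minl. Qed.

Lemma count_take_homo (s : seq bool) :
  {homo (fun k => count id (take k s)) : j k / j <= k}.
Proof.
move=> j k jk; rewrite -[in leqRHS](cat_take_drop j (take k s)).
by rewrite count_cat take_takel ?leq_addr.
Qed.

(** Discrete intermediate value property: prefix counts start at 0 and grow by at most 1 per step.
    This is what makes the image of [of_steps s] an interval. *)
Lemma count_take_surj (s : seq bool) k v :
  k <= size s -> v <= count id (take k s) ->
  exists2 j, j <= k & count id (take j s) = v.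
Proof.
elim: k => [|k IHk] ks; first by rewrite take0 leqn0 => /eqP->; exists 0; rewrite ?take0.
rewrite leq_eqVlt => /predU1P[->|]; first by exists k.+1.
rewrite count_take_succ // => v_lt.
have [|j jk <-] := IHk (ltnW ks); last by exists j; rewrite // leqW.
by rewrite -ltnS (leq_trans v_lt) // -addn1 leq_add2l leq_b1.
Qed.

(** Bit [i] of [s] tells whether the map increases from [i] to [i.+1]. The count is at most [x],
    hence at most [m], so [inord] never takes its default value. *)
Definition of_steps m (s : m.-tuple bool) : transf m.+1 :=
  [ffun x : 'I_m.+1 => inord (count id (take x s))].

Lemma of_stepsE m (s : m.-tuple bool) (x : 'I_m.+1) :
  of_steps s x = count id (take x s) :> nat.
Proof. by rewrite ffunE inordK // (leq_ltn_trans (count_take_le s x)). Qed.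

(** Each bit is the difference of two consecutive prefix counts, and these are the values of the
    map. *)
Lemma of_steps_inj m : injective (@of_steps m).
Proof.
move=> s t st; apply/val_inj/(@eq_from_nth _ false); rewrite !size_tuple // => i im.
have E k : k <= m -> count id (take k s) = count id (take k t).
  by rewrite -ltnS => km; have := of_stepsE s (Ordinal km); rewrite st of_stepsE.
have := E _ im; rewrite !count_take_succ ?size_tuple // E 1?ltnW //.
by move/addnI; do 2!case: nth.
Qed.

Lemma of_steps_IO_minus m (s : m.-tuple bool) : of_steps s \in IO_minus m.+1.
Proof.
apply/IO_minusP; split=> [x y xy||x].
- by rewrite !of_stepsE count_take_homo.
- apply/forallP=> x; apply/forallP=> y; apply/forallP=> z; apply/implyP.
  case/and4P=> _ yz _ /codomP[w zE].
  (* Here [z] is the value at [w], so [y] is at most the count of the prefix of length [w] and is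
     attained at some [j <= w]. *)
  have [||j jw jE] := @count_take_surj s w y; first by rewrite size_tuple -ltnS.
    by rewrite -of_stepsE -zE.
  apply/codomP; exists (Ordinal (leq_ltn_trans jw (ltn_ord w))).
  by apply: val_inj; rewrite /= of_stepsE.
- by rewrite of_stepsE count_take_le.
Qed.

Lemma IO_minus_of_steps m (a : transf m.+1) :
  a \in IO_minus m.+1 -> exists s, a = of_steps s.
Proof.
case/IO_minusP=> a_mono aI a_le.
pose s := [tuple a (inord i) < a (inord i.+1) | i < m].
(* Writing the argument as [inord x] leaves a claim about a natural number, ready for induction. *)
exists s; apply/ffunP=> x; apply: val_inj; rewrite /= of_stepsE -{1}(inord_val x).
have : x <= m by rewrite -ltnS.
elim: (x : nat) => [_|k IHk km].
  (* The condition [a x <= x] forces the least point to be fixed. *)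
  by apply/eqP; rewrite take0 -leqn0 (leq_trans (a_le _)) // inordK.
rewrite count_take_succ ?size_tuple // -IHk 1?ltnW //.
rewrite (nth_mktuple _ _ (Ordinal km)) /=.
have kE : (inord k.+1 : 'I_m.+1) = (inord k : 'I_m.+1).+1 :> nat.
  by rewrite !inordK // ltnS ltnW.
have := interval_image_succ a_mono aI kE.
have : a (inord k) <= a (inord k.+1) by apply: a_mono; rewrite kE.
(* A strict increase is squeezed to exactly 1 by the bound from the interval condition. *)
by case: ltngtP => // [lt _ le|->]; rewrite ?addn0 // addn1; apply/eqP; rewrite eqn_leq le.
Qed.

Lemma card_IO_minus m : #|IO_minus m.+1| = 2 ^ m.
Proof.
have -> : IO_minus m.+1 = [set of_steps s | s : m.-tuple bool].
  apply/setP=> a; apply/idP/imsetP=> [/IO_minus_of_steps[s ->]|[s _ ->]].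
    by exists s.
  exact: of_steps_IO_minus.
by rewrite card_imset ?card_tuple ?card_bool //; apply: of_steps_inj.
Qed.

Definition rev_transf n (a : transf n) : transf n :=
  [ffun x => rev_ord (a (rev_ord x))].

Lemma rev_transfK n : involutive (@rev_transf n).
Proof. by move=> a; apply/ffunP=> x; rewrite !ffunE !rev_ordK. Qed.

Lemma leq_rev_ord n (x y : 'I_n) : (rev_ord x <= rev_ord y) = (y <= x).
Proof. by rewrite /= leq_sub2lE. Qed.

Lemma codom_rev_transf n (a : transf n) y :
  (y \in codom (rev_transf a)) = (rev_ord y \in codom a).
Proof.
apply/codomP/codomP=> -[x xE]; exists (rev_ord x).
  by rewrite xE ffunE rev_ordK.
by rewrite ffunE rev_ordK -xE rev_ordK.
Qed.

(** Reversal swaps the ends of every inequality, so each condition for the conjugate is the one for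
    [a] at the reversed points in the opposite order. *)
Lemma rev_transf_IO n (a : transf n) : a \in IO n -> rev_transf a \in IO n.
Proof.
rewrite !inE => /andP[a_mono aI]; apply/andP; split.
  apply/forallP=> x; apply/forallP=> y; apply/implyP=> xy.
  rewrite !ffunE leq_rev_ord.
  by move/forallP/(_ (rev_ord y))/forallP/(_ (rev_ord x))/implyP: a_mono; apply; rewrite leq_rev_ord.
apply/forallP=> x; apply/forallP=> y; apply/forallP=> z; apply/implyP.
rewrite !codom_rev_transf => /and4P[xy yz xa za].
move/forallP/(_ (rev_ord z))/forallP/(_ (rev_ord y))/forallP/(_ (rev_ord x)): aI.
by move/implyP; apply; rewrite !leq_rev_ord xy yz xa za.
Qed.

Lemma rev_transf_IO_plus n (a : transf n) :
  (rev_transf a \in IO_plus n) = (a \in IO_minus n).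
Proof.
rewrite [LHS]inE [RHS]inE; congr (_ && _).
  (* Conjugation is an involution, so its preservation of [IO n] gives both directions. *)
  by apply/idP/idP=> /rev_transf_IO //; rewrite rev_transfK.
apply/forallP/forallP=> H x; have := H (rev_ord x); rewrite ffunE.
  by rewrite rev_ordK leq_rev_ord.
by rewrite -leq_rev_ord rev_ordK.
Qed.

Lemma card_IO_plus n : #|IO_plus n| = #|IO_minus n|.
Proof.
rewrite -[RHS](card_imset _ (can_inj (@rev_transfK n))); congr #|pred_of_set _|.
apply/setP=> a; apply/idP/imsetP=> [aP|[b bM ->]]; last by rewrite rev_transf_IO_plus.
by exists (rev_transf a); rewrite ?rev_transfK // -rev_transf_IO_plus rev_transfK.
Qed.

Theorem proposition3p2 (n : nat) (hn : 1 <= n) :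
  #|IO_minus n| = 2 ^ (n - 1) /\ #|IO_plus n| = 2 ^ (n - 1).
Proof.
by rewrite card_IO_plus; case: n hn => // m _; rewrite card_IO_minus subn1.
Qed.
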